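(* Let $V$ be a finite set, let $f \colon 2^V \to \mathbb{R}$ be strictly submodular, let $S \subseteq V$ be unknown, and let $g(X) = f(X \vartriangle S)$ be accessible only via a function value oracle. Then a set $T \subseteq V$ such that $X \mapsto g(X \vartriangle T)$ is submodular can be found in $2|V|\cdot \mathbf{EO} + \mathrm{O}(|V|)$ time, where $\mathbf{EO}$ is the time of one oracle call returning $g(X)$ for a given $X \subseteq V$.
   Context: $X \vartriangle S$ is the symmetric difference. A set function $h$ on $2^V$ is submodular if $\Phi_h(X,Y) := h(X)+h(Y)-h(X\cup Y)-h(X \cap Y) \ge 0$ for all $X,Y \subseteq V$; it is strictly submodular if moreover $\Phi_h(X,Y) > 0$ whenever both $X\setminus Y$ and $Y \setminus X$ are nonempty. *)

(* Defs.v *)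
From HB Require Import structures.
From mathcomp Require Import all_boot all_order all_algebra.
From mathcomp Require Export reals.

Set Implicit Arguments.
Unset Strict Implicit.
Unset Printing Implicit Defensive.

Import Order.TTheory GRing.Theory Num.Theory.
Local Open Scope ring_scope.

Definition symdiff (V : finType) (X S : {set V}) : {set V} :=
  (X :\: S) :|: (S :\: X).

Section Submodularity.

Variables (R : realType) (V : finType).
Implicit Types (h : {set V} -> R) (X Y : {set V}).

Definition Phi h X Y : R := h X + h Y - h (X :|: Y) - h (X :&: Y).

Definition submodular h : Prop := forall X Y, 0 <= Phi h X Y.

Definition strictly_submodular h : Prop :=
  submodular h /\
  forall X Y, X :\: Y != set0 -> Y :\: X != set0 -> 0 < Phi h X Y.

End Submodularity.

(* Algorithms are programs for a unit-cost real RAM with an oracle.  It has a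
   memory of natural numbers and a separate memory of real numbers, both with
   direct and indirect addressing.  Naturals can only be incremented,
   decremented and compared: after t steps they exceed the input and the
   constants of the program by at most t, so unit cost hides no work on long
   words.  Reals influence naturals only through the conditional jump. *)

Variant loc := Dir of nat | Ind of nat.

Variant rop := OpAdd | OpSub | OpMul | OpDiv.

(* The last argument of each jump is an absolute position in the program. *)
Variant instr :=
  | NSet of loc & nat
  | NMove of loc & loc
  | NIncr of loc
  | NDecr of loc
  | NJumpLe of loc & loc & nat
  | RSet of loc & nat
  | RMove of loc & loc
  | ROp of rop & loc & loc & loc
  | RJumpLe of loc & loc & nat
  | Query of loc & loc.

Definition program := seq instr.

Definition upd (A : Type) (m : nat -> A) (a : nat) (x : A) : nat -> A :=
  fun b => if b == a then x else m b.

Definition addr (m : nat -> nat) (l : loc) : nat :=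
  match l with Dir a => a | Ind a => m a end.

(* A subset of V is stored as a characteristic vector occupying #|V|
   consecutive cells from address b; V is identified with {0, ..., #|V| - 1}
   by its enumeration. *)
Definition set_at (V : finType) (m : nat -> nat) (b : nat) : {set V} :=
  [set v : V | m (b + enum_rank v)%N != 0%N].

Section Machine.

Variable R : realType.

Record config := Config {
  pc : nat;
  nmem : nat -> nat;
  rmem : nat -> R }.

Definition rop_eval (o : rop) (x y : R) : R :=
  match o with
  | OpAdd => x + y | OpSub => x - y | OpMul => x * y | OpDiv => x / y
  end.

Section Oracle.

Variables (V : finType) (g : {set V} -> R).

(* Query d b calls the oracle on the set stored from the address held in the
   natural cell b, and puts the answer in the real cell d. *)
Definition step (i : instr) (s : config) : config :=
  let m := nmem s in
  let r := rmem s in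
  let a := addr m in
  let next := (pc s).+1 in
  match i with
  | NSet d k => Config next (upd m (a d) k) r
  | NMove d x => Config next (upd m (a d) (m (a x))) r
  | NIncr d => Config next (upd m (a d) (m (a d)).+1) r
  | NDecr d => Config next (upd m (a d) (m (a d)).-1) r
  | NJumpLe x y p => Config (if (m (a x) <= m (a y))%N then p else next) m r
  | RSet d k => Config next m (upd r (a d) k%:R)
  | RMove d x => Config next m (upd r (a d) (r (a x)))
  | ROp o d x y =>
      Config next m (upd r (a d) (rop_eval o (r (a x)) (r (a y))))
  | RJumpLe x y p => Config (if r (a x) <= r (a y) then p else next) m r
  | Query d b => Config next m (upd r (a d) (g (set_at V m (m (a b)))))
  end.

Definition cost (EO : nat) (i : instr) : nat :=
  match i with Query _ _ => EO | _ => 1 end.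

(* [halts P EO s s' t]: started in s, P stops in s' after time t, when an
   oracle call takes time EO.  P stops when pc points outside P. *)
Inductive halts (P : program) (EO : nat) : config -> config -> nat -> Prop :=
  | halts_stop s : onth P (pc s) = None -> halts P EO s s 0
  | halts_step s i s' t :
      onth P (pc s) = Some i -> halts P EO (step i s) s' t ->
      halts P EO s s' (cost EO i + t)%N.

End Oracle.

(* The input |V| is in natural cell 0, every other cell is 0. *)
Definition init (n : nat) : config :=
  Config 0 (upd (fun=> 0%N) 0 n) (fun=> 0).

(* On halting, natural cell 0 holds the address of the returned set. *)
Definition output (V : finType) (s : config) : {set V} :=
  set_at V (nmem s) (nmem s 0%N).

End Machine.

(* Main.v *)
Require Import Defs.
From HB Require Import structures.
From mathcomp Require Import all_boot all_order all_algebra.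
From mathcomp Require Import reals.
From mathcomp Require Import zify lra.

Set Implicit Arguments.
Unset Strict Implicit.
Unset Printing Implicit Defensive.

Import Order.TTheory GRing.Theory Num.Theory.

(** Write [D X = g (u |: X) - g X] for a fixed element [u].  For [v != u] and
    any [X] avoiding [u] and [v], strict submodularity of [f] gives
    [D (v |: X) < D X] if [u] and [v] lie on the same side of [S], and
    [D X < D (v |: X)] otherwise.  Scanning the elements, one therefore grows
    in place the set [T] of those separated from [u] by [S]: each element costs
    the two queries of [D (v |: T)], as [D T] is known from the previous steps,
    and the initial value [D set0] costs two more.  At the end [T] is [S] or
    its complement, so that [g (symdiff X T)] is [f X] or [f (~: X)]. *)

(** * Symmetric differences and complements *)

Lemma in_symdiff (V : finType) (X S : {set V}) x :
  (x \in symdiff X S) = (x \in X) (+) (x \in S).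
Proof. by rewrite !inE; case: (x \in X); case: (x \in S). Qed.

(** Complementation exchanges union and intersection, so [Phi] merely has its arguments
    complemented. This serves the case where the set found is the complement of [S]. *)
Lemma submodular_setC (R : realType) (V : finType) (f : {set V} -> R) :
  submodular f -> submodular (fun X => f (~: X)).
Proof.
by move=> fsub X Y; have := fsub (~: X) (~: Y); rewrite /Phi setCU setCI; lra.
Qed.

Lemma eq_submodular (R : realType) (V : finType) (f h : {set V} -> R) :
  f =1 h -> submodular f -> submodular h.
Proof. by move=> fh fsub X Y; rewrite /Phi -!fh; apply: fsub. Qed.

(** * Sides of [S] read off from marginal values *)

Section Separation.

Variables (R : realType) (V : finType) (f : {set V} -> R) (S : {set V}).
Hypothesis fstrict : strictly_submodular f.

Let g X := f (symdiff X S).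

Definition marginal (u : V) (X : {set V}) : R := (g (u |: X) - g X)%R.

Lemma strictly_submodular_pair (W : {set V}) u v :
  u != v -> u \notin W -> v \notin W ->
  (f W + f (u |: (v |: W)) < f (u |: W) + f (v |: W))%R.
Proof.
move=> uv uW vW.
have uD : (u |: W) :\: (v |: W) != set0.
  by apply/set0Pn; exists u; rewrite !inE eqxx (negPf uv) (negPf uW).
have vD : (v |: W) :\: (u |: W) != set0.
  by apply/set0Pn; exists v; rewrite !inE eqxx eq_sym (negPf uv) (negPf vW).
have := fstrict.2 _ _ uD vD; rewrite /Phi.
have -> : (u |: W) :|: (v |: W) = u |: (v |: W).
  apply/setP => x; rewrite !inE.
  by case: (x == u); case: (x == v); case: (x \in W).
have -> : (u |: W) :&: (v |: W) = W.
  apply/setP => x; rewrite !inE.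
  case: (eqVneq x u) => [->|_]; first by rewrite (negPf uv) (negPf uW).
  by case: (x == v); case: (x \in W).
lra.
Qed.

(** Symmetric difference with [S] maps the four corners of the square spanned by [u] and [v] above
    [X] onto those above some [W], and opposite corners stay opposite. Strict submodularity at [W]
    therefore separates the two marginals strictly, in a direction that depends on which diagonal
    receives [X]. *)
Lemma marginal_le_setU1 u v (X : {set V}) :
  u != v -> u \notin X -> v \notin X ->
  (marginal u X <= marginal u (v |: X))%R = (v \in S) (+) (u \in S).
Proof.
move=> uv uX vX; rewrite /marginal /g.
pose W := symdiff X S :\: [set u; v].
have uW : u \notin W by rewrite !inE eqxx.
have vW : v \notin W by rewrite !inE eqxx orbT.
have := strictly_submodular_pair uv uW vW.
have setE (A B : {set V}) :
    (forall x, x != u -> x != v -> (x \in A) = (x \in B)) ->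
    (u \in A) = (u \in B) -> (v \in A) = (v \in B) -> A = B.
  move=> AB ABu ABv; apply/setP => x.
  by case: (eqVneq x u) => [->//|xu]; case: (eqVneq x v) => [->//|]; apply: AB.
have inW x : x != u -> x != v -> (x \in W) = (x \in X) (+) (x \in S).
  by move=> xu xv; rewrite in_setD in_symdiff !inE (negPf xu) (negPf xv).
have vu : v == u = false by rewrite eq_sym (negPf uv).
have symE (A B : {set V}) :
    (forall x, x != u -> x != v -> (x \in A) = (x \in X)) ->
    (forall x, x != u -> x != v -> (x \in B) = (x \in W)) ->
    (u \in A) (+) (u \in S) = (u \in B) ->
    (v \in A) (+) (v \in S) = (v \in B) ->
    symdiff A S = B.
  move=> AX BW Au Av; apply: setE; rewrite ?in_symdiff // => x xu xv.
  by rewrite in_symdiff AX // BW // inW.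
have U1E w (A : {set V}) x : x != w -> (x \in w |: A) = (x \in A).
  by move=> xw; rewrite !inE (negPf xw).
have memU1 w w' (A : {set V}) : (w \in w' |: A) = (w == w') || (w \in A).
  by rewrite !inE.
pose memE := (memU1, eqxx, vu, negPf uv, negPf uX, negPf vX,
              negPf uW, negPf vW).
(* [X] lands on [W] enlarged by whichever of [u] and [v] lie in [S]; this fixes the other three
   corners. *)
case uS: (u \in S); case vS: (v \in S) => fW /=.
- rewrite (symE X (u |: (v |: W))) ?(symE (u |: X) (v |: W))
    ?(symE (v |: X) (u |: W)) ?(symE (u |: (v |: X)) W);
    try by [move=> *; rewrite ?U1E | rewrite ?memE ?uS ?vS].
  by apply/negbTE; rewrite -ltNge; lra.
- rewrite (symE X (u |: W)) ?(symE (u |: X) W)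
    ?(symE (v |: X) (u |: (v |: W))) ?(symE (u |: (v |: X)) (v |: W));
    try by [move=> *; rewrite ?U1E | rewrite ?memE ?uS ?vS].
  lra.
- rewrite (symE X (v |: W)) ?(symE (u |: X) (u |: (v |: W)))
    ?(symE (v |: X) W) ?(symE (u |: (v |: X)) (u |: W));
    try by [move=> *; rewrite ?U1E | rewrite ?memE ?uS ?vS].
  lra.
- rewrite (symE X W) ?(symE (u |: X) (u |: W))
    ?(symE (v |: X) (v |: W)) ?(symE (u |: (v |: X)) (u |: (v |: W)));
    try by [move=> *; rewrite ?U1E | rewrite ?memE ?uS ?vS].
  by apply/negbTE; rewrite -ltNge; lra.
Qed.

(** The state of [T] once the elements of rank below [j] are decided; [u] never belongs to it. *)
Definition separated (u : V) (j : nat) : {set V} :=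
  [set v | (enum_rank v < j) && ((v \in S) (+) (u \in S))].

Lemma separatedS u v :
  separated u (enum_rank v).+1 =
  if (v \in S) (+) (u \in S) then v |: separated u (enum_rank v)
  else separated u (enum_rank v).
Proof.
apply/setP => x; have [->|xv] := eqVneq x v.
  by case: ifP => e; rewrite !inE ?eqxx e ltnSn ?andbF.
have -> : (x \in separated u (enum_rank v).+1) =
          (x \in separated u (enum_rank v)).
  rewrite !inE ltnS leq_eqVlt.
  by rewrite (inj_eq val_inj) (inj_eq enum_rank_inj) (negPf xv).
by case: ifP => // _; rewrite !inE (negPf xv).
Qed.

Lemma submodular_separated u :
  submodular (fun X => g (symdiff X (separated u #|V|))).
Proof.
have sepE x : (x \in separated u #|V|) = (x \in S) (+) (u \in S).
  by rewrite inE ltn_ord.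
case uS: (u \in S); last first.
  apply: eq_submodular fstrict.1 => X; congr f; apply/setP => x.
  by rewrite !in_symdiff sepE uS; case: (x \in X); case: (x \in S).
apply: eq_submodular (submodular_setC fstrict.1) => X; congr f.
apply/setP => x.
by rewrite !in_symdiff sepE uS !inE; case: (x \in X); case: (x \in S).
Qed.

End Separation.

(** * Sets stored as characteristic vectors *)

Section Memory.

Lemma upd_same (A : Type) (m : nat -> A) a x : upd m a x a = x.
Proof. by rewrite /upd eqxx. Qed.

Lemma upd_neq (A : Type) (m : nat -> A) a b x :
  b != a -> upd m a x b = m b.
Proof. by rewrite /upd => /negPf ->. Qed.

Variable V : finType.

Lemma set_at_upd_lt (m : nat -> nat) a b x :
  a < b -> set_at V (upd m a x) b = set_at V m b.
Proof. by move=> ab; apply/setP => v; rewrite !inE upd_neq //; lia. Qed.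

Lemma set_at_upd_rank (m : nat -> nat) b v x :
  set_at V (upd m (b + enum_rank v) x) b =
  if x == 0 then set_at V m b :\ v else v |: set_at V m b.
Proof.
apply/setP => w; rewrite inE /upd eqn_add2l (inj_eq val_inj).
rewrite (inj_eq enum_rank_inj).
by case: (x == 0) / eqP => [->|/eqP x0]; rewrite !inE;
   case: (eqVneq w v) => // _; rewrite ?x0.
Qed.

End Memory.

(* In the loop, natural cell 0 holds the address 3 of the set T under
   construction, cell 1 the address of the current element and cell 2 the first
   address past T.  The element at address 3 is the fixed element u, and real
   cell 0 holds the marginal value of u at T. *)
Definition separate : program :=
  [:: NMove (Dir 2) (Dir 0);
      NIncr (Dir 2);
      NIncr (Dir 2);
      NIncr (Dir 2);
      NSet (Dir 0) 3;
      NSet (Dir 1) 4;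
      NJumpLe (Dir 2) (Dir 0) 25;
      Query (Dir 0) (Dir 0);
      NSet (Dir 3) 1;
      Query (Dir 1) (Dir 0);
      NSet (Dir 3) 0;
      ROp OpSub (Dir 0) (Dir 1) (Dir 0);
(* 12 *) NJumpLe (Dir 2) (Dir 1) 25;
      NSet (Ind 1) 1;
      Query (Dir 2) (Dir 0);
      NSet (Dir 3) 1;
      Query (Dir 1) (Dir 0);
      NSet (Dir 3) 0;
      ROp OpSub (Dir 1) (Dir 1) (Dir 2);
      RJumpLe (Dir 0) (Dir 1) 22;
      NSet (Ind 1) 0;
      NJumpLe (Dir 0) (Dir 0) 23;
(* 22 *) RMove (Dir 0) (Dir 1);
(* 23 *) NIncr (Dir 1);
      NJumpLe (Dir 0) (Dir 0) 12].

(** * Execution and running time *)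

Section Execution.

Variables (R : realType) (V : finType) (f : {set V} -> R) (S : {set V}).
Hypothesis fstrict : strictly_submodular f.
Variables (EO : nat) (u : V).
Hypothesis rank_u : enum_rank u = 0 :> nat.

Let g X := f (symdiff X S).

(** A form of [halts_step] with cost and successor state as equations, so that the program can be
    run symbolically, one instruction at a time. *)
Lemma halts_next (P : program) i (s s1 s' : config R) t t' :
  onth P (pc s) = Some i -> t' = cost EO i + t -> step g i s = s1 ->
  halts g P EO s1 s' t -> halts g P EO s s' t'.
Proof. by move=> Pi -> <-; apply: halts_step. Qed.

(** As [u] has rank 0, its cell has the fixed address 3, and direct addressing suffices to insert or
    remove it. *)
Lemma set_at_head (m : nat -> nat) x :
  set_at V (upd m 3 x) 3 =
  if x == 0 then set_at V m 3 :\ u else u |: set_at V m 3.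
Proof. by rewrite -set_at_upd_rank rank_u. Qed.

(** Induction on the number [k] of elements left to scan. An iteration makes two queries and at most
    ten other steps, so 12 leaves slack; the final 1 pays for the exit test. *)
Lemma loop_halts k j (m : nat -> nat) (r : nat -> R) :
  0 < j -> j + k = #|V| ->
  m 0 = 3 -> m 1 = j.+3 -> m 2 = #|V|.+3 ->
  set_at V m 3 = separated S u j ->
  r 0 = marginal f S u (separated S u j) ->
  exists s t,
    [/\ halts g separate EO (Config 12 m r) s t,
        output V s = separated S u #|V| &
        t <= k * (2 * EO + 12) + 1].
Proof.
elim: k j m r => [|k IHk] j m r j_gt0 jk m0 m1 m2 mT r0.
  rewrite addn0 in jk; exists (Config 25 m r), (1 + 0); split=> //.
    apply: halts_next; [by []|by []| |by apply: halts_stop].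
    by rewrite /= m1 m2 jk leqnn.
  by rewrite /output /= m0 mT jk.
have jV : j < #|V| by lia.
pose v := enum_val (Ordinal jV).
have rank_v : enum_rank v = j :> nat by rewrite enum_valK.
have uv : u != v.
  by apply/eqP => uv; move: rank_u; rewrite uv rank_v; lia.
pose T := separated S u j.
have uT : u \notin T by rewrite inE addbb andbF.
have vT : v \notin T by rewrite inE rank_v ltnn.
(* Memory when the marginals are compared: [v] is inserted tentatively, and [u] was inserted for the
   second query, then removed. *)
pose m3 := upd (upd (upd m j.+3 1) 3 1) 3 0.
have m3E a : a < 3 -> m3 a = m a by move=> a3; rewrite /m3 !upd_neq //; lia.
have j3 : j.+3 = 3 + enum_rank v by rewrite rank_v.
have m1T : set_at V (upd m j.+3 1) 3 = v |: T.
  by rewrite j3 set_at_upd_rank mT.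
have m2T : set_at V (upd (upd m j.+3 1) 3 1) 3 = u |: (v |: T).
  by rewrite set_at_head m1T.
have m3T : set_at V m3 3 = v |: T.
  by rewrite set_at_head m2T /= setU1K // in_setU1 negb_or uv uT.
pose r3 := upd (upd (upd r 2 (g (v |: T))) 1 (g (u |: (v |: T)))) 1
               (marginal f S u (v |: T)).
have [s [t [st out tle]]] : exists s t,
    [/\ halts g separate EO (Config 19 m3 r3) s t,
        output V s = separated S u #|V| &
        t <= 5 + (k * (2 * EO + 12) + 1)].
  have := marginal_le_setU1 S fstrict uv uT vT; rewrite /= => sepE.
  have := separatedS S u v; rewrite rank_v -sepE -/T => TS.
  have r30 : r3 0 = marginal f S u T by rewrite /r3 !upd_neq.
  have r31 : r3 1 = marginal f S u (v |: T) by rewrite /r3 upd_same.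
  case: ifP TS => le TS.
  (* [v] is kept, and the marginal just computed becomes the one at the new [T]. *)
  - have [] := IHk j.+1 (upd m3 1 j.+4) (upd r3 0 (r3 1)).
    + by [].
    + by lia.
    + by rewrite upd_neq // m3E.
    + by rewrite upd_same.
    + by rewrite upd_neq // m3E.
    + by rewrite set_at_upd_lt // m3T TS.
    + by rewrite upd_same r31 TS.
    move=> s [t [st out tle]]; exists s, (1 + (1 + (1 + (1 + t)))).
    split; [|by []|by lia].
    apply: halts_next; [by []|by []|by rewrite /= r30 r31 le|].
    apply: halts_next; [by []|by []|by []|].
    apply: halts_next; [by []|by []|by rewrite /= m3E ?m1|].
    by apply: halts_next; [by []|by []|by rewrite /= leqnn|].
  (* [v] is erased again; [T] is unchanged, so real cell 0 is still correct. *)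
  - have [] := IHk j.+1 (upd (upd m3 j.+3 0) 1 j.+4) r3.
    + by [].
    + by lia.
    + by rewrite !upd_neq // m3E.
    + by rewrite upd_same.
    + by rewrite !upd_neq // m3E.
    + by rewrite set_at_upd_lt // j3 set_at_upd_rank m3T TS /= setU1K.
    + by rewrite r30 TS.
    move=> s [t [st out tle]]; exists s, (1 + (1 + (1 + (1 + (1 + t))))).
    split; [|by []|by lia].
    apply: halts_next; [by []|by []|by rewrite /= r30 r31 le|].
    apply: halts_next; [by []|by []|by rewrite /= m3E ?m1|].
    apply: halts_next; [by []|by []|by rewrite /= leqnn|].
    apply: halts_next; [by []|by []|by rewrite /= upd_neq ?m3E ?m1|].
    by apply: halts_next; [by []|by []|by rewrite /= leqnn|].
exists s, (1 + (1 + (EO + (1 + (EO + (1 + (1 + t))))))); split=> //; last first.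
  by rewrite mulSn; lia.
apply: halts_next; [by []|by []|by rewrite /= m1 m2 leqNgt !ltnS jV|].
apply: halts_next; [by []|by []|by rewrite /= m1|].
apply: halts_next; [by []|by []|by rewrite /= upd_neq ?m0 ?m1T|].
apply: halts_next; [by []|by []|by []|].
apply: halts_next; [by []|by []|by rewrite /= !upd_neq ?m0 ?m2T|].
apply: halts_next; [by []|by []|by []|].
apply: halts_next; [by []|by []| |exact: st].
by rewrite /= upd_same upd_neq ?upd_same.
Qed.

End Execution.

(** Two queries before the loop and two for each of the [#|V| - 1] elements other than [u] make
    [2 * #|V|]. *)
Lemma separate_halts (R : realType) (V : finType) (f : {set V} -> R)
    (S : {set V}) (EO : nat) :
  strictly_submodular f ->
  let g := fun X => f (symdiff X S) in
  exists (s : config R) t,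
    [/\ halts g separate EO (init R #|V|) s t,
        submodular (fun X => g (symdiff X (output V s))) &
        t <= 2 * #|V| * EO + 13 * (#|V| + 1)].
Proof.
move=> fstrict g.
pose m0 := upd (fun=> 0) 0 #|V|.
pose m6 := upd (upd (upd (upd (upd (upd m0 2 #|V|) 2 #|V|.+1) 2 #|V|.+2)
                     2 #|V|.+3) 0 3) 1 4.
have start s t : halts g separate EO (Config 6 m6 (fun=> 0%R)) s t ->
    halts g separate EO (init R #|V|) s (1 + (1 + (1 + (1 + (1 + (1 + t)))))).
  move=> st.
  by do 6 (apply: halts_next; [by []|by []|by []|]).
(* For empty [V] there is no [u] and the bound leaves no time for a query: the guard exits first. *)
have [V0|V_gt0] := posnP #|V|.
  exists (Config 25 m6 (fun=> 0%R)),
    (1 + (1 + (1 + (1 + (1 + (1 + (1 + 0))))))); split.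
  - apply: start.
    have stop : m6 2 <= m6 0 by rewrite /m6 /upd /= V0.
    apply: halts_next; [by []|by []| |by apply: halts_stop].
    by rewrite /= stop.
  - have setE (X Y : {set V}) : X = Y.
      by apply/setP => x; have := fintype0 x V0.
    by move=> X Y; rewrite /Phi (setE X Y) setUid setIid; lra.
  - by rewrite /=; lia.
pose u := enum_val (Ordinal V_gt0).
have rank_u : enum_rank u = 0 :> nat by rewrite enum_valK.
(* The cells from address 3 on still hold their initial 0. *)
have m6T : set_at V m6 3 = set0.
  by apply/setP => x; rewrite !inE.
pose m8 := upd m6 3 1.
have m8T : set_at V m8 3 = [set u].
  by rewrite (set_at_head rank_u) m6T setU0.
have T1 : separated S u 1 = set0.
  apply/setP => x; rewrite !inE ltnS leqn0; apply/negbTE/negP => /andP[/eqP x0].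
  suff -> : x = u by rewrite addbb.
  by apply/enum_rank_inj/val_inj; rewrite /= x0 rank_u.
pose r0 : nat -> R := fun=> 0%R.
pose r2 := upd (upd r0 0 (g set0)) 1 (g [set u]).
have [] := @loop_halts R V f S fstrict EO u rank_u #|V|.-1 1 (upd m8 3 0)
             (upd r2 0 (g [set u] - g set0)%R).
- by [].
- by lia.
- by [].
- by [].
- by [].
- by rewrite (set_at_head rank_u) m8T T1 setDv.
- by rewrite upd_same T1 /marginal setU0.
move=> s [t [st out tle]]; exists s, (1 + (1 + (1 + (1 + (1 + (1 +
  (1 + (EO + (1 + (EO + (1 + (1 + t)))))))))))); split.
- have enter : (m6 2 <= m6 0) = false by rewrite /m6 /upd /= leqNgt !ltnS V_gt0.
  apply: start.
  apply: halts_next; [by []|by []|by rewrite /= enter|].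
  apply: halts_next; [by []|by []|by rewrite /= -[m6 0]/3 m6T|].
  apply: halts_next; [by []|by []|by []|].
  apply: halts_next; [by []|by []|by rewrite /= -/m8 -[m8 0]/3 m8T|].
  apply: halts_next; [by []|by []|by []|].
  by apply: halts_next; [by []|by []| |exact: st].
- by rewrite out; apply: submodular_separated.
- by move: tle; rewrite -[in X in _ -> X](prednK V_gt0); lia.
Qed.

Theorem theorem4p2 (R : realType) :
  exists (P : program) (c : nat),
  forall (V : finType) (f : {set V} -> R) (S : {set V}) (EO : nat),
    strictly_submodular f ->
    let g := fun X : {set V} => f (symdiff X S) in
    exists (s : config R) (t : nat),
      [/\ halts g P EO (init R #|V|) s t,
          submodular (fun X : {set V} => g (symdiff X (output V s))) &
          t <= 2 * #|V| * EO + c * (#|V| + 1)].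
Proof. by exists separate, 13 => V f S EO; apply: separate_halts. Qed.
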